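(* The $D_6$-symmetric Casimir elements $\Omega_A,\Omega_B,\Omega_C$ of $\Re$, viewed in $\mathfrak{BI}$ via $\zeta$, have the following expressions: $$\zeta(\Omega_A)=\frac{\lambda(\lambda-2\iota+3)(4\iota^2-8\iota-4\kappa-4\lambda-4\mu+7)}{1024}-\Gamma,$$ $$\zeta(\Omega_B)=\frac{\mu(\mu-2\iota+3)(4\iota^2-8\iota-4\kappa-4\lambda-4\mu+7)}{1024}-\Gamma,$$ $$\zeta(\Omega_C)=\frac{\kappa(\kappa-2\iota+3)(4\iota^2-8\iota-4\kappa-4\lambda-4\mu+7)}{1024}-\Gamma,$$ where $$\Gamma=\frac{3(2\iota+3)(2\iota+1)(2\iota-5)(2\iota-7)}{4096}-\frac{(2\iota+1)(6\iota-13)(\kappa+\lambda+\mu)}{512}+\frac{(\kappa+\lambda+\mu)(\kappa+\lambda+\mu+4)}{64}-\frac{(2\iota-3)(\kappa\lambda+\lambda\mu+\mu\kappa)}{512}+\frac{\kappa\lambda\mu}{256}.$$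
   Context: $\mathbb F$ is a field with $\operatorname{char}\mathbb F\neq 2$. Algebras are associative with unit $1$. $[a,b]=ab-ba$ and $\{a,b\}=ab+ba$. The Racah algebra $\Re$ is the $\mathbb F$-algebra defined by generators $A,B,C,D$ and the relations asserting that $[A,B]=[B,C]=[C,A]=2D$ and that each of $\alpha=[A,D]+AC-BA$, $\beta=[B,D]+BA-CB$, $\gamma=[C,D]+CB-AC$ is central in $\Re$. Put $\delta=A+B+C$ (also central). The $D_6$-symmetric Casimir elements of $\Re$ are $$\Omega_A=D^2+\frac{BAC+CAB}{2}+A^2+B\gamma-C\beta-A\delta,$$ $$\Omega_B=D^2+\frac{CBA+ABC}{2}+B^2+C\alpha-A\gamma-B\delta,$$ $$\Omega_C=D^2+\frac{ACB+BCA}{2}+C^2+A\beta-B\alpha-C\delta.$$ The Bannai--Ito algebra $\mathfrak{BI}$ is the $\mathbb F$-algebra defined by generators $X,Y,Z$ and the relations asserting that each of $\kappa=\{X,Y\}-Z$, $\lambda=\{Y,Z\}-X$, $\mu=\{Z,X\}-Y$ is central in $\mathfrak{BI}$. Put $\iota=X+Y+Z$. $\zeta\colon\Re\to\mathfrak{BI}$ is the unique $\mathbb F$-algebra homomorphism (known to exist) that sends $A\mapsto \frac{(2X-3)(2X+1)}{16}$, $B\mapsto \frac{(2Y-3)(2Y+1)}{16}$, $C\mapsto\frac{(2Z-3)(2Z+1)}{16}$; it is injective and $\Re$ is viewed as a subalgebra of $\mathfrak{BI}$ via $\zeta$. *)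

(* Defs.v *)
From HB Require Import structures.
From mathcomp Require Import all_boot all_algebra.
From mathcomp Require Import boolp.
From mathcomp Require Import monalg.

Set Implicit Arguments.
Unset Strict Implicit.
Unset Printing Implicit Defensive.

Import GRing.Theory.
Local Open Scope ring_scope.
Local Open Scope quotient_scope.

Inductive in_ideal (R : nzRingType) (S : R -> Prop) : R -> Prop :=
| in_ideal_gen x : S x -> in_ideal S x
| in_ideal0 : in_ideal S 0
| in_idealD x y : in_ideal S x -> in_ideal S y -> in_ideal S (x + y)
| in_idealM a x b : in_ideal S x -> in_ideal S (a * x * b).

(* In MathComp an algebra is nontrivial, so relators come with a proof that
   they do not generate the unit ideal. *)
Record relators (R : nzRingType) := Relators {
  relator :> R -> Prop;
  relatorsP : ~ in_ideal relator 1
}.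

Lemma in_ideal_ker (R T : nzRingType) (S : R -> Prop) (f : {rmorphism R -> T}) :
  (forall x, S x -> f x = 0) -> forall x, in_ideal S x -> f x = 0.
Proof.
move=> fS x; elim=> {x} [x /fS //||x y _ fx _ fy|a x b _ fx].
- exact: rmorph0.
- by rewrite rmorphD fx fy addr0.
- by rewrite !rmorphM fx mulr0 mul0r.
Qed.

Lemma in_ideal_proper (R T : nzRingType) (S : R -> Prop)
    (f : {rmorphism R -> T}) :
  (forall x, S x -> f x = 0) -> ~ in_ideal S 1.
Proof.
move=> /in_ideal_ker fS /fS; rewrite rmorph1 => /eqP.
by rewrite oner_eq0.
Qed.

Section TwoSidedQuotient.
Context (F : fieldType) (R : algType F) (S : relators R).

Definition ideal_pred (x : R) := `[< in_ideal S x >].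

Lemma ideal_predP x : reflect (in_ideal S x) (x \in ideal_pred).
Proof. exact: asboolP. Qed.

Lemma ideal_pred_zmod : zmod_closed ideal_pred.
Proof.
split=> [|x y /ideal_predP Sx /ideal_predP Sy]; apply/ideal_predP.
  exact: in_ideal0.
apply: in_idealD => //; have := in_idealM (- 1) 1 Sy.
by rewrite mulr1 mulN1r.
Qed.

HB.instance Definition _ :=
  GRing.isZmodClosed.Build R ideal_pred ideal_pred_zmod.

Lemma ideal_predM a x b : x \in ideal_pred -> a * x * b \in ideal_pred.
Proof. by move=> /ideal_predP Sx; apply/ideal_predP/in_idealM. Qed.

Definition ideal : zmodClosed R := GRing.ZmodClosed.clone R ideal_pred _.

Definition algquot : Type := Quotient.quot ideal.
HB.instance Definition _ := Choice.on algquot.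
HB.instance Definition _ := EqQuotient.on algquot.
HB.instance Definition _ := GRing.Zmodule.on algquot.

Definition algpi (x : R) : algquot := \pi x.

Lemma algpi_eq x y : algpi x = algpi y <-> x - y \in ideal_pred.
Proof.
rewrite (Quotient.idealrBE ideal).
by split=> [/eqP //|/eqP].
Qed.

Lemma algpiB : {morph algpi : x y / x - y}.
Proof. by move=> x y; rewrite /algpi !piE. Qed.

Lemma algpiK (q : algquot) : algpi (repr q) = q.
Proof. exact: reprK. Qed.

Lemma algpiD : {morph algpi : x y / x + y}.
Proof. by move=> x y; rewrite /algpi !piE. Qed.

(* Locked: otherwise a product of the quotient unfolds to the image of a
   product, and rewriting with rmorphM loops. *)
Fact algquot_key : unit. Proof. by []. Qed.

Definition algquot_mul : algquot -> algquot -> algquot :=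
  locked_with algquot_key (fun p q => algpi (repr p * repr q)).

Lemma algpiM x y : algpi (x * y) = algquot_mul (algpi x) (algpi y).
Proof.
rewrite /algquot_mul unlock; apply/algpi_eq; set x' := repr _; set y' := repr _.
have Ix : x - x' \in ideal_pred by apply/algpi_eq; rewrite algpiK.
have Iy : y - y' \in ideal_pred by apply/algpi_eq; rewrite algpiK.
have -> : x * y - x' * y' = 1 * (x - x') * y + x' * (y - y') * 1.
  by rewrite mul1r mulr1 mulrBl mulrBr addrA subrK.
by rewrite rpredD ?ideal_predM.
Qed.

Lemma algquot_mulA : associative algquot_mul.
Proof.
by move=> p q r; rewrite -[p]algpiK -[q]algpiK -[r]algpiK -!algpiM mulrA.
Qed.

Lemma algquot_mul1l : left_id (algpi 1) algquot_mul.
Proof. by move=> p; rewrite -[p]algpiK -algpiM mul1r. Qed.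

Lemma algquot_mul1r : right_id (algpi 1) algquot_mul.
Proof. by move=> p; rewrite -[p]algpiK -algpiM mulr1. Qed.

Lemma algquot_mulDl : left_distributive algquot_mul +%R.
Proof.
move=> p q r; rewrite -[p]algpiK -[q]algpiK -[r]algpiK.
by rewrite -algpiD -!algpiM -algpiD mulrDl.
Qed.

Lemma algquot_mulDr : right_distributive algquot_mul +%R.
Proof.
move=> p q r; rewrite -[p]algpiK -[q]algpiK -[r]algpiK.
by rewrite -algpiD -!algpiM -algpiD mulrDr.
Qed.

Lemma algquot1_neq0 : algpi 1 != 0.
Proof.
have <- : algpi 0 = 0 by rewrite -[0]subr0 algpiB subrr.
apply/eqP => /algpi_eq; rewrite subr0 => /ideal_predP.
exact: relatorsP.
Qed.

HB.instance Definition _ := GRing.Zmodule_isNzRing.Build algquot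
  algquot_mulA algquot_mul1l algquot_mul1r algquot_mulDl algquot_mulDr
  algquot1_neq0.

HB.instance Definition _ := GRing.isZmodMorphism.Build R algquot algpi algpiB.
HB.instance Definition _ := GRing.isMonoidMorphism.Build R algquot algpi
  (erefl, algpiM).

Definition algquot_scale : F -> algquot -> algquot :=
  locked_with algquot_key (fun c q => algpi c%:A * q).

Lemma algpiZ c x : algpi (c *: x) = algquot_scale c (algpi x).
Proof. by rewrite /algquot_scale unlock -rmorphM /= mulr_algl. Qed.

Lemma algquot_scaleA a b q :
  algquot_scale a (algquot_scale b q) = algquot_scale (a * b) q.
Proof. by rewrite -[q]algpiK -!algpiZ scalerA. Qed.

Lemma algquot_scale1 : left_id 1 algquot_scale.
Proof. by move=> q; rewrite -[q]algpiK -algpiZ scale1r. Qed.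

Lemma algquot_scaleDr : right_distributive algquot_scale +%R.
Proof. by move=> c p q; rewrite /algquot_scale unlock mulrDr. Qed.

Lemma algquot_scaleDl q : {morph algquot_scale^~ q : a b / a + b}.
Proof. by move=> a b; rewrite /algquot_scale unlock scalerDl rmorphD mulrDl. Qed.

HB.instance Definition _ := GRing.Zmodule_isLmodule.Build F algquot
  algquot_scaleA algquot_scale1 algquot_scaleDr algquot_scaleDl.

Lemma algquot_scalerAl (c : F) (p q : algquot) : c *: (p * q) = (c *: p) * q.
Proof. by rewrite /GRing.scale /= /algquot_scale unlock mulrA. Qed.

HB.instance Definition _ := GRing.Lmodule_isLalgebra.Build F algquot
  algquot_scalerAl.

HB.instance Definition _ :=
  GRing.isScalable.Build F R algquot *:%R algpi algpiZ.

Lemma algquot_scalerAr (c : F) (p q : algquot) : c *: (p * q) = p * (c *: q).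
Proof.
have piZ x : c *: algpi x = algpi (c *: x) by rewrite algpiZ.
by rewrite -[p]algpiK -[q]algpiK -rmorphM !piZ -rmorphM scalerAr.
Qed.

HB.instance Definition _ := GRing.Lalgebra_isAlgebra.Build F algquot
  algquot_scalerAr.

Lemma algpi_relator x : S x -> algpi x = 0.
Proof.
move=> Sx; rewrite -(raddf0 algpi); apply/algpi_eq; rewrite subr0.
exact/ideal_predP/in_ideal_gen.
Qed.

Lemma algquot_lift (B : lalgType F) (f : {lrmorphism R -> B}) :
  (forall x, S x -> f x = 0) ->
  exists g : {lrmorphism algquot -> B}, forall x, g (algpi x) = f x.
Proof.
move=> fS; have fI := in_ideal_ker fS.
pose g (q : algquot) := f (repr q).
have gE x : g (algpi x) = f x.
  apply/eqP; rewrite -subr_eq0 -rmorphB; apply/eqP/fI/ideal_predP/algpi_eq.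
  exact: algpiK.
have gB : zmod_morphism g.
  by move=> p q; rewrite -[p]algpiK -[q]algpiK -rmorphB !gE rmorphB.
have gM : monoid_morphism g.
  split=> [|p q]; first by rewrite -(rmorph1 algpi) gE rmorph1.
  by rewrite -[p]algpiK -[q]algpiK -rmorphM !gE rmorphM.
have gZ : scalable g.
  by move=> c q; rewrite -[q]algpiK -linearZ !gE linearZ.
pose ga := GRing.isZmodMorphism.Build _ _ g gB.
pose gm := GRing.isMonoidMorphism.Build _ _ g gM.
pose gs := GRing.isScalable.Build _ _ _ _ g gZ.
pose G : {lrmorphism algquot -> B} := HB.pack g ga gm gs.
by exists G.
Qed.

End TwoSidedQuotient.

Section FreeAlgebra.
Context (F : fieldType) (I : choiceType).

Lemma freealg_scalerAr (c : F) (x y : {malg F[{fmonom I}]}) :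
  c *: (x * y) = x * (c *: y).
Proof.
suff Zr (z : {malg F[{fmonom I}]}) : c *: z = z * c%:MP
  by rewrite scalerAl (Zr x) -mulrA mul_malgC.
rewrite (monalgE z) mulr_suml scaler_sumr; apply: eq_bigr => k _.
by rewrite -mul_malgC !malgM_def !fgmulUU mul1m mulm1 mulrC.
Qed.

(* A fresh name, since malg already has an algebra instance, which applies to
   commutative monomials only. *)
Definition freealg : Type := {malg F[{fmonom I}]}.
HB.instance Definition _ := GRing.Lalgebra.copy freealg {malg F[{fmonom I}]}.
HB.instance Definition _ :=
  GRing.Lalgebra_isAlgebra.Build F freealg freealg_scalerAr.

Fact freegen_key : unit. Proof. by []. Qed.

Definition freegen : I -> freealg :=
  locked_with freegen_key (fun i => << fmu i >>).

Lemma freealg_lift (B : algType F) (b : I -> B) :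
  exists f : {lrmorphism freealg -> B}, forall i, f (freegen i) = b i.
Proof.
pose h (m : {fmonom I}) := \prod_(i <- (m : seq I)) b i.
have hM : mmorphism h.
  by split=> [x y|]; rewrite /h ?fmM ?fm1 ?big_cat ?big_nil.
pose H : {mmorphism {fmonom I} -> B} :=
  HB.pack h (isMultiplicative.Build _ _ h hM).
pose g : freealg -> B := mmap (in_alg B) H.
have gM : monoid_morphism g.
  have [|gM g1] := @commr_mmap_is_multiplicative _ _ _ (in_alg B) H.
    by move=> x m m'; rewrite /GRing.comm /= mulr_algl mulr_algr.
  by split.
have gZ : scalable g by move=> c x; rewrite /g mmapZ /= mulr_algl.
have gB : zmod_morphism g by move=> x y; rewrite /g mmapB.
pose ga := GRing.isZmodMorphism.Build _ _ g gB.
pose gm := GRing.isMonoidMorphism.Build _ _ g gM.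
pose gs := GRing.isScalable.Build _ _ _ _ g gZ.
pose G : {lrmorphism freealg -> B} := HB.pack g ga gm gs.
exists G => i; rewrite /G /= /g /freegen unlock mmapU /= scale1r mul1r.
by rewrite /h fmU big_seq1.
Qed.

Lemma freealg_augmentation :
  exists f : {rmorphism freealg -> F}, forall i, f (freegen i) = 0.
Proof. by have [f fE] := @freealg_lift F^o (fun=> 0); exists f. Qed.
End FreeAlgebra.

Definition commutator (R : nzRingType) (x y : R) : R := x * y - y * x.
Definition anticommutator (R : nzRingType) (x y : R) : R := x * y + y * x.

Lemma rmorph_comm (R T : nzRingType) (f : {rmorphism R -> T}) x y :
  f (commutator x y) = commutator (f x) (f y).
Proof. by rewrite /commutator rmorphB !rmorphM. Qed.

Lemma rmorph_commutator (R : nzRingType) (T : comNzRingType)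
    (f : {rmorphism R -> T}) x y : f (commutator x y) = 0.
Proof. by rewrite rmorphB !rmorphM /= mulrC subrr. Qed.

Section RacahFormulas.
Context (R : nzRingType) (A B C D : R).
Definition racah_alpha := commutator A D + A * C - B * A.
Definition racah_beta := commutator B D + B * A - C * B.
Definition racah_gamma := commutator C D + C * B - A * C.
Definition racah_delta := A + B + C.

Inductive racah_relation : R -> Prop :=
| racah_AB : racah_relation (commutator A B - 2 * D)
| racah_BC : racah_relation (commutator B C - 2 * D)
| racah_CA : racah_relation (commutator C A - 2 * D)
| racah_alpha_central t : racah_relation (commutator racah_alpha t)
| racah_beta_central t : racah_relation (commutator racah_beta t)
| racah_gamma_central t : racah_relation (commutator racah_gamma t).

Definition racah_laws : Prop :=
  [/\ commutator A B = 2 * D, commutator B C = 2 * D, commutator C A = 2 * D &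
   forall t, [/\ commutator racah_alpha t = 0, commutator racah_beta t = 0
               & commutator racah_gamma t = 0]].

Lemma racah_relation_proper (T : comNzRingType) (f : {rmorphism R -> T}) :
  f D = 0 -> ~ in_ideal racah_relation 1.
Proof.
move=> fD; apply: (in_ideal_proper (f := f)) => x.
have f2D : f (2 * D) = 0 by rewrite rmorphM /= fD mulr0.
by case=> *; rewrite ?rmorph_commutator // rmorphB /= f2D rmorph_commutator subr0.
Qed.
End RacahFormulas.

Lemma racah_laws_morph (R T : nzRingType) (f : {rmorphism R -> T})
    (s : T -> R) (A B C D : R) :
  (forall x, racah_relation A B C D x -> f x = 0) -> cancel s f ->
  racah_laws (f A) (f B) (f C) (f D).
Proof.
move=> fR sK.
have f2D x y : f (commutator x y - 2 * D) = commutator (f x) (f y) - 2 * f D.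
  by rewrite rmorphB rmorph_comm rmorphM rmorph_nat.
split; last move=> t.
- by apply/eqP; rewrite -subr_eq0 -f2D fR //; constructor.
- by apply/eqP; rewrite -subr_eq0 -f2D fR //; constructor.
- by apply/eqP; rewrite -subr_eq0 -f2D fR //; constructor.
have fa : f (racah_alpha A B C D) = racah_alpha (f A) (f B) (f C) (f D).
  by rewrite /racah_alpha !(rmorphB, rmorphD, rmorphM, rmorph_comm).
have fb : f (racah_beta A B C D) = racah_beta (f A) (f B) (f C) (f D).
  by rewrite /racah_beta !(rmorphB, rmorphD, rmorphM, rmorph_comm).
have fc : f (racah_gamma A B C D) = racah_gamma (f A) (f B) (f C) (f D).
  by rewrite /racah_gamma !(rmorphB, rmorphD, rmorphM, rmorph_comm).
by rewrite -fa -fb -fc -[t]sK -!rmorph_comm; split; apply: fR; constructor.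
Qed.

Lemma racah_laws_relation (R T : nzRingType) (f : {rmorphism R -> T})
    (A B C D : R) : racah_laws (f A) (f B) (f C) (f D) ->
  forall x, racah_relation A B C D x -> f x = 0.
Proof.
have f2D x y : f (commutator x y - 2 * D) = commutator (f x) (f y) - 2 * f D.
  by rewrite rmorphB rmorph_comm rmorphM rmorph_nat.
move=> [AB BC CA cen] x.
case=> [|||t|t|t]; rewrite ?f2D ?(AB, BC, CA) ?subrr //; rewrite rmorph_comm.
- by have [<- _ _] := cen (f t);
  rewrite /racah_alpha !(rmorphB, rmorphD, rmorphM, rmorph_comm).
- by have [_ <- _] := cen (f t);
  rewrite /racah_beta !(rmorphB, rmorphD, rmorphM, rmorph_comm).
- by have [_ _ <-] := cen (f t);
  rewrite /racah_gamma !(rmorphB, rmorphD, rmorphM, rmorph_comm).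
Qed.

Inductive racah_gen := GA | GB | GC | GD.
HB.instance Definition _ := gen_eqMixin racah_gen.
HB.instance Definition _ := gen_choiceMixin racah_gen.

Section RacahAlgebra.
Context (F : fieldType).

Definition racah_relators : relators (freealg F racah_gen).
Proof.
exists (racah_relation (freegen F GA) (freegen F GB)
                       (freegen F GC) (freegen F GD)).
have [f fE] := freealg_augmentation F racah_gen.
exact: racah_relation_proper (fE GD).
Defined.

Definition racah : algType F := algquot racah_relators.

Definition racah_elt (g : racah_gen) : racah := algpi _ (freegen F g).

Lemma racah_eltP : racah_laws (racah_elt GA) (racah_elt GB)
                              (racah_elt GC) (racah_elt GD).
Proof.
pose f : {rmorphism freealg F racah_gen -> algquot racah_relators} :=
  algpi racah_relators.
apply: (racah_laws_morph (f := f)); last exact: algpiK.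
exact: (@algpi_relator _ _ racah_relators).
Qed.

Lemma racah_lift (T : algType F) (g : racah_gen -> T) :
  racah_laws (g GA) (g GB) (g GC) (g GD) ->
  exists f : {lrmorphism racah -> T}, forall i, f (racah_elt i) = g i.
Proof.
move=> gP; have [f fE] := freealg_lift g.
rewrite -!fE in gP; have fP := racah_laws_relation (f := f) gP.
have [h hE] := algquot_lift (S := racah_relators) fP.
by exists h => i; rewrite /racah_elt hE fE.
Qed.
End RacahAlgebra.

Section CasimirElements.
Context (F : fieldType).
Local Notation A := (racah_elt F GA).
Local Notation B := (racah_elt F GB).
Local Notation C := (racah_elt F GC).
Local Notation D := (racah_elt F GD).
Local Notation alpha := (racah_alpha A B C D).
Local Notation beta := (racah_beta A B C D).
Local Notation gamma := (racah_gamma A B C D).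
Local Notation delta := (racah_delta A B C).

Definition Omega_A : racah F :=
  D ^+ 2 + 2^-1 *: (B * A * C + C * A * B) + A ^+ 2
  + B * gamma - C * beta - A * delta.
Definition Omega_B : racah F :=
  D ^+ 2 + 2^-1 *: (C * B * A + A * B * C) + B ^+ 2
  + C * alpha - A * gamma - B * delta.
Definition Omega_C : racah F :=
  D ^+ 2 + 2^-1 *: (A * C * B + B * C * A) + C ^+ 2
  + A * beta - B * alpha - C * delta.
End CasimirElements.

Section BannaiItoFormulas.
Context (R : nzRingType) (X Y Z : R).
Definition bi_kappa := anticommutator X Y - Z.
Definition bi_lambda := anticommutator Y Z - X.
Definition bi_mu := anticommutator Z X - Y.
Definition bi_iota := X + Y + Z.

Inductive bi_relation : R -> Prop :=
| bi_kappa_central t : bi_relation (commutator bi_kappa t)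
| bi_lambda_central t : bi_relation (commutator bi_lambda t)
| bi_mu_central t : bi_relation (commutator bi_mu t).

Definition bi_laws : Prop :=
  forall t, [/\ commutator bi_kappa t = 0, commutator bi_lambda t = 0
              & commutator bi_mu t = 0].

Lemma bi_relation_proper (T : comNzRingType) (f : {rmorphism R -> T}) :
  ~ in_ideal bi_relation 1.
Proof.
apply: (in_ideal_proper (f := f)) => x.
by case=> t; rewrite rmorph_commutator.
Qed.
End BannaiItoFormulas.

Lemma bi_laws_morph (R T : nzRingType) (f : {rmorphism R -> T})
    (s : T -> R) (X Y Z : R) :
  (forall x, bi_relation X Y Z x -> f x = 0) -> cancel s f ->
  bi_laws (f X) (f Y) (f Z).
Proof.
move=> fR sK t.
have fk : f (bi_kappa X Y Z) = bi_kappa (f X) (f Y) (f Z).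
  by rewrite /bi_kappa !(rmorphB, rmorphD, rmorphM).
have fl : f (bi_lambda X Y Z) = bi_lambda (f X) (f Y) (f Z).
  by rewrite /bi_lambda !(rmorphB, rmorphD, rmorphM).
have fm : f (bi_mu X Y Z) = bi_mu (f X) (f Y) (f Z).
  by rewrite /bi_mu !(rmorphB, rmorphD, rmorphM).
by rewrite -fk -fl -fm -[t]sK -!rmorph_comm; split; apply: fR; constructor.
Qed.

Lemma bi_laws_relation (R T : nzRingType) (f : {rmorphism R -> T})
    (X Y Z : R) : bi_laws (f X) (f Y) (f Z) ->
  forall x, bi_relation X Y Z x -> f x = 0.
Proof.
move=> cen x; case=> t; have [k l m] := cen (f t); rewrite rmorph_comm.
- by rewrite -[RHS]k /bi_kappa !(rmorphB, rmorphD, rmorphM).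
- by rewrite -[RHS]l /bi_lambda !(rmorphB, rmorphD, rmorphM).
- by rewrite -[RHS]m /bi_mu !(rmorphB, rmorphD, rmorphM).
Qed.

Inductive bi_gen := GX | GY | GZ.
HB.instance Definition _ := gen_eqMixin bi_gen.
HB.instance Definition _ := gen_choiceMixin bi_gen.

Section BannaiItoAlgebra.
Context (F : fieldType).

Definition bi_relators : relators (freealg F bi_gen).
Proof.
exists (bi_relation (freegen F GX) (freegen F GY) (freegen F GZ)).
have [f _] := freealg_augmentation F bi_gen.
exact: bi_relation_proper f.
Defined.

Definition bannai_ito : algType F := algquot bi_relators.

Definition bi_elt (g : bi_gen) : bannai_ito := algpi _ (freegen F g).

Lemma bi_eltP : bi_laws (bi_elt GX) (bi_elt GY) (bi_elt GZ).
Proof.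
pose f : {rmorphism freealg F bi_gen -> algquot bi_relators} :=
  algpi bi_relators.
apply: (bi_laws_morph (f := f)); last exact: algpiK.
exact: (@algpi_relator _ _ bi_relators).
Qed.

Lemma bi_lift (T : algType F) (g : bi_gen -> T) :
  bi_laws (g GX) (g GY) (g GZ) ->
  exists f : {lrmorphism bannai_ito -> T}, forall i, f (bi_elt i) = g i.
Proof.
move=> gP; have [f fE] := freealg_lift g.
rewrite -!fE in gP; have fP := bi_laws_relation (f := f) gP.
have [h hE] := algquot_lift (S := bi_relators) fP.
by exists h => i; rewrite /bi_elt hE fE.
Qed.
End BannaiItoAlgebra.

(* Main.v *)
(* The relations of the Bannai-Ito algebra say that kappa, lambda, mu are central
   and that YX = -XY + Z + kappa, ZY = -YZ + X + lambda, ZX = -XZ + Y + mu.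
   Read from left to right they rewrite every element into a combination of the
   ordered monomials kappa^r lambda^s mu^t X^i Y^j Z^k.  Since char F != 2, the
   image of D is [zeta A, zeta B] / 2, so both sides of each identity are
   explicit expressions in X, Y, Z, kappa, lambda, mu with coefficients in
   Z[1/2], and their ordered forms coincide. *)
From Stdlib Require Import ZArith.
Require Import Defs.
From HB Require Import structures.
From mathcomp Require Import all_boot all_algebra.
From mathcomp Require Import ssrZ.

Import GRing.Theory.
Local Open Scope ring_scope.

(** * Dyadic rationals with binary numerators, as computable coefficients *)

Section Dyadic.
Context (F : fieldType).

(* [(z, n)] stands for z / 2^n. *)
Definition dyadic : Type := Z * nat.

Definition dyadic_val (c : dyadic) : F := (int_of_Z c.1)%:~R * 2^-1 ^+ c.2.

(** Fractions are never reduced: the later test for zero looks at numerators only. *)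
Definition dyadic_add (c d : dyadic) : dyadic :=
  if (c.2 <= d.2)%N then (c.1 * 2 ^+ (d.2 - c.2) + d.1, d.2)
  else (c.1 + d.1 * 2 ^+ (c.2 - d.2), c.2).

Definition dyadic_mul (c d : dyadic) : dyadic := (c.1 * d.1, (c.2 + d.2)%N).

Lemma dyadic_val_shift (z : Z) (m n : nat) : (2 != 0 :> F) -> (m <= n)%N ->
  dyadic_val (z * 2 ^+ (n - m), n) = dyadic_val (z, m).
Proof.
move=> nz2 le_mn; rewrite /dyadic_val /= -{2}(subnK le_mn) exprD.
have two : (int_of_Z 2)%:~R = 2 :> F by [].
rewrite rmorphM rmorphXn /= rmorphM rmorphXn /= two -mulrA (mulrA (_ ^+ _)).
by rewrite -exprMn mulfV // expr1n mul1r.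
Qed.

Lemma dyadic_valD (c d : dyadic) : (2 != 0 :> F) ->
  dyadic_val (dyadic_add c d) = dyadic_val c + dyadic_val d.
Proof.
have valD (y z : Z) n :
    dyadic_val (y + z, n) = dyadic_val (y, n) + dyadic_val (z, n).
  by rewrite /dyadic_val /= !rmorphD mulrDl.
case: c d => [y m] [z n] nz2; rewrite /dyadic_add /=.
by case: leqP => [le_mn|/ltnW le_nm]; rewrite valD dyadic_val_shift.
Qed.

Lemma dyadic_valM (c d : dyadic) :
  dyadic_val (dyadic_mul c d) = dyadic_val c * dyadic_val d.
Proof. by rewrite /dyadic_val /= !rmorphM exprD mulrACA. Qed.
End Dyadic.

(** * Noncommutative polynomials as lists of weighted words *)

Definition word := seq nat.
Definition ncpoly := seq (dyadic * word).

Fixpoint add_term (t : dyadic * word) (p : ncpoly) : ncpoly :=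
  if p is s :: p' then
    if t.2 == s.2 then (dyadic_add t.1 s.1, t.2) :: p' else s :: add_term t p'
  else [:: t].

Definition ncpoly_add (p q : ncpoly) : ncpoly := foldr add_term q p.

Definition ncpoly_scale (c : dyadic) (p : ncpoly) : ncpoly :=
  [seq (dyadic_mul c t.1, t.2) | t <- p].

(** The linear extension of [f] to polynomials. *)
Definition ncpoly_bind (p : ncpoly) (f : word -> ncpoly) : ncpoly :=
  foldr (fun t q => ncpoly_add (ncpoly_scale t.1 (f t.2)) q) [::] p.

Definition monomial (w : word) : ncpoly := [:: ((1, 0%N), w)].

Inductive expr :=
| Letter of nat
| Const of nat
| Add of expr & expr
| Opp of expr
| Mul of expr & expr
| Exp of expr & nat
| Halve of nat & expr.

(** * Normal forms under quadratic rewriting rules *)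

Section Normalisation.
Context (rule : nat -> nat -> option ncpoly).

(* [fuel] bounds the number of nested rewrites; when it runs out the word is
   left unreduced, which is still sound. *)
Fixpoint letter_mul (fuel g : nat) (w : word) : ncpoly :=
  if fuel is n.+1 then
    if w is h :: w' then
      if rule g h is Some p then
        ncpoly_bind p (fun u =>
          foldr (fun a q => ncpoly_bind q (letter_mul n a)) (monomial w') u)
      else monomial (g :: w)
    else monomial (g :: w)
  else monomial (g :: w).

(** [letter_mul] inspects only the front of a word, so the letters of [u] are inserted last one
    first into the already ordered [q]. *)
Definition ncpoly_mul (fuel : nat) (p q : ncpoly) : ncpoly :=
  ncpoly_bind p (fun u =>
    foldr (fun a r => ncpoly_bind r (letter_mul fuel a)) q u).

Fixpoint normalise (fuel : nat) (e : expr) : ncpoly :=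
  match e with
  | Letter g => monomial [:: g]
  | Const n => [:: ((Z.of_nat n, 0%N), [::])]
  | Add e1 e2 => ncpoly_add (normalise fuel e1) (normalise fuel e2)
  | Opp e1 => ncpoly_scale (-1, 0%N) (normalise fuel e1)
  | Mul e1 e2 => ncpoly_mul fuel (normalise fuel e1) (normalise fuel e2)
  | Exp e1 n => iter n (ncpoly_mul fuel (normalise fuel e1)) (monomial [::])
  | Halve n e1 => ncpoly_scale (1, n) (normalise fuel e1)
  end.

(** Cancelled words stay in the list with numerator 0, hence a test on coefficients instead of
    emptiness. *)
Definition equal_mod (fuel : nat) (e1 e2 : expr) : bool :=
  all (fun t => Z.eqb t.1.1 Z0) (normalise fuel (Add e1 (Opp e2))).

Context (F : fieldType) (R : algType F) (val : nat -> R).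
Hypothesis nz2 : 2 != 0 :> F.

Definition word_eval (w : word) : R := \prod_(g <- w) val g.
Definition ncpoly_eval (p : ncpoly) : R :=
  \sum_(t <- p) dyadic_val F t.1 *: word_eval t.2.

Fixpoint eval (e : expr) : R :=
  match e with
  | Letter g => val g
  | Const n => n%:R
  | Add e1 e2 => eval e1 + eval e2
  | Opp e1 => - eval e1
  | Mul e1 e2 => eval e1 * eval e2
  | Exp e1 n => eval e1 ^+ n
  | Halve n e1 => 2^-1 ^+ n *: eval e1
  end.

Lemma add_term_eval t p :
  ncpoly_eval (add_term t p) =
  dyadic_val F t.1 *: word_eval t.2 + ncpoly_eval p.
Proof.
rewrite /ncpoly_eval; elim: p => [|s p IHp] /=.
  by rewrite big_seq1 big_nil addr0.
case: eqP => [eq_ts|_]; rewrite !big_cons /=.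
  by rewrite dyadic_valD // scalerDl {2}eq_ts addrA.
by rewrite IHp addrCA.
Qed.

Lemma ncpoly_addE p q :
  ncpoly_eval (ncpoly_add p q) = ncpoly_eval p + ncpoly_eval q.
Proof.
elim: p => [|t p IHp] /=; first by rewrite /ncpoly_eval big_nil add0r.
by rewrite add_term_eval IHp addrA /ncpoly_eval big_cons.
Qed.

Lemma ncpoly_scaleE c p :
  ncpoly_eval (ncpoly_scale c p) = dyadic_val F c *: ncpoly_eval p.
Proof.
rewrite /ncpoly_eval big_map scaler_sumr; apply: eq_bigr => t _.
by rewrite dyadic_valM scalerA.
Qed.

(** The left factor serves [foldr_bindE], which multiplies by a letter; the right one carries the
    fixed tail in [letter_mulE] and the second operand in [ncpoly_mulE]. *)
Lemma ncpoly_bindE a b p f :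
    (forall w, ncpoly_eval (f w) = a * word_eval w * b) ->
  ncpoly_eval (ncpoly_bind p f) = a * ncpoly_eval p * b.
Proof.
move=> fE; elim: p => [|t p IHp] /=.
  by rewrite /ncpoly_eval big_nil mulr0 mul0r.
rewrite ncpoly_addE ncpoly_scaleE fE IHp /ncpoly_eval big_cons mulrDr mulrDl.
by rewrite -scalerAr -scalerAl.
Qed.

Lemma monomialE w : ncpoly_eval (monomial w) = word_eval w.
Proof. by rewrite /ncpoly_eval big_seq1 /dyadic_val mulr1 rmorph1 scale1r. Qed.

(** An abstract [f] covers both the recursive calls with less fuel and the top-level call of
    [letter_mul]. *)
Lemma foldr_bindE f q u :
    (forall g w, ncpoly_eval (f g w) = val g * word_eval w) ->
  ncpoly_eval (foldr (fun a r => ncpoly_bind r (f a)) q u) =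
  word_eval u * ncpoly_eval q.
Proof.
move=> fE; rewrite /word_eval; elim: u => [|a u IHu] /=.
  by rewrite big_nil mul1r.
rewrite (ncpoly_bindE (val a) 1) => [|w]; last by rewrite fE mulr1.
by rewrite IHu big_cons mulr1 mulrA.
Qed.

Hypothesis ruleP :
  forall g h p, rule g h = Some p -> val g * val h = ncpoly_eval p.

Lemma letter_mulE fuel g w :
  ncpoly_eval (letter_mul fuel g w) = val g * word_eval w.
Proof.
have consE : ncpoly_eval (monomial (g :: w)) = val g * word_eval w.
  by rewrite monomialE /word_eval big_cons.
elim: fuel g w consE => [|n IHn] g [|h w] consE //=.
case ruleE: (rule g h) => [p|] //.
(* The rule replaces the first two letters by [p]; the words of [p] are then multiplied back onto
   the tail, which the induction hypothesis covers. *)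
rewrite (ncpoly_bindE 1 (word_eval w)) => [|u].
  by rewrite mul1r -(ruleP _ _ _ ruleE) {2}/word_eval big_cons mulrA.
rewrite foldr_bindE ?monomialE ?mul1r // => a v.
by apply: IHn; rewrite monomialE /word_eval big_cons.
Qed.

Lemma ncpoly_mulE fuel p q :
  ncpoly_eval (ncpoly_mul fuel p q) = ncpoly_eval p * ncpoly_eval q.
Proof.
rewrite (ncpoly_bindE 1 (ncpoly_eval q)) ?mul1r // => u.
by rewrite foldr_bindE ?mul1r // => g w; exact: letter_mulE.
Qed.

Lemma normaliseE fuel e : ncpoly_eval (normalise fuel e) = eval e.
Proof.
elim: e => [g|n|e1 E1 e2 E2|e E|e1 E1 e2 E2|e E n|n e E] /=.
- by rewrite monomialE /word_eval big_seq1.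
- rewrite /ncpoly_eval big_seq1 /word_eval big_nil /dyadic_val mulr1 /=.
  have -> : int_of_Z (Z.of_nat n) = n by rewrite -[RHS]Z_of_intK.
  by rewrite scaler_nat.
- by rewrite ncpoly_addE E1 E2.
- by rewrite ncpoly_scaleE E /dyadic_val mulr1 scaleN1r.
- by rewrite ncpoly_mulE E1 E2.
- elim: n => [|n IHn] /=; first by rewrite monomialE /word_eval big_nil.
  by rewrite ncpoly_mulE E IHn exprS.
- by rewrite ncpoly_scaleE E /dyadic_val rmorph1 mul1r.
Qed.

(** Normalisation preserves values, so the difference equals a combination whose coefficients all
    vanish. *)
Lemma equal_mod_sound fuel e1 e2 : equal_mod fuel e1 e2 -> eval e1 = eval e2.
Proof.
move/allP=> zero; apply/eqP; rewrite -subr_eq0.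
rewrite -[_ - _]/(eval (Add e1 (Opp e2))) -(normaliseE fuel).
rewrite /ncpoly_eval big_seq big1 // => t /zero /Z.eqb_eq t0.
by rewrite /dyadic_val t0 mul0r scale0r.
Qed.
End Normalisation.

Arguments word_eval {F R} val w.
Arguments ncpoly_eval {F R} val p.
Arguments eval {F R} val e.

(* Letters 0, 1, 2 stand for the central elements kappa, lambda, mu and 3, 4, 5
   for X, Y, Z; the rules sort a word into increasing order. *)
Definition bi_rule (g h : nat) : option ncpoly :=
  let swap := ((-1, 0%N), [:: h; g]) : dyadic * word in
  if (g <= h)%N then None
  else if (h < 3)%N then Some (monomial [:: h; g])
  else match g, h with
  | 4, 3 => Some (swap :: monomial [:: 5] ++ monomial [:: 0])
  | 5, 4 => Some (swap :: monomial [:: 3] ++ monomial [:: 1])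
  | 5, 3 => Some (swap :: monomial [:: 4] ++ monomial [:: 2])
  | _, _ => None
  end%N.

(** * Validity of the Bannai-Ito rewriting rules *)

Section BannaiItoRules.
Context (F : fieldType) (R : algType F) (X Y Z : R).

Definition bi_val (g : nat) : R :=
  nth 0 [:: bi_kappa X Y Z; bi_lambda X Y Z; bi_mu X Y Z; X; Y; Z] g.

Lemma bi_ruleP : bi_laws X Y Z -> forall g h p,
  bi_rule g h = Some p -> bi_val g * bi_val h = ncpoly_eval bi_val p.
Proof.
move=> laws.
have central g t : (g < 3)%N -> t * bi_val g = bi_val g * t.
  have [k l m] := laws t.
  by case: g => [|[|[|//]]] _; apply/esym/subr0_eq.
have sortE g h : ncpoly_eval bi_val (monomial [:: h; g]) = bi_val h * bi_val g.
  by rewrite monomialE /word_eval !big_cons big_nil mulr1.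
have ruleE g h i k : ncpoly_eval bi_val
    (((-1, 0%N), [:: h; g]) :: monomial [:: i] ++ monomial [:: k]) =
    - (bi_val h * bi_val g) + (bi_val i + bi_val k).
  rewrite /ncpoly_eval !big_cons big_nil /word_eval !big_cons !big_nil.
  by rewrite /dyadic_val /= !mulr1 rmorphN1 scaleN1r !scale1r addr0.
move=> g h p; rewrite /bi_rule; case: ifP => // _.
case: ifP => [lt_h3 [<-]|_]; first by rewrite sortE central.
(* The surviving products are [Y * X], [Z * X], [Z * Y], governed by kappa, mu, lambda in this
   order. *)
case: g => [|[|[|[|[|[|g]]]]]] //; case: h => [|[|[|[|[|h]]]]] // [<-];
  rewrite ruleE /bi_val /= addrC /bi_kappa /bi_lambda /bi_mu /anticommutator.
- by rewrite (addrC Z) subrK addrAC subrr add0r.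
- by rewrite (addrC Y) subrK addrK.
- by rewrite (addrC X) subrK addrAC subrr add0r.
Qed.
End BannaiItoRules.

Arguments bi_val {F R} X Y Z g.

(** A scalar that is not a power is read as 1/2. A misreading is harmless: [apply] must convert the
    evaluated tree back to the goal. *)
Ltac reify val t :=
  lazymatch t with
  | ?a + ?b => let x := reify val a in let y := reify val b in constr:(Add x y)
  | - ?a => let x := reify val a in constr:(Opp x)
  | ?a * ?b => let x := reify val a in let y := reify val b in constr:(Mul x y)
  | ?a ^+ ?n => let x := reify val a in constr:(Exp x n)
  | _ ^+ ?n *: ?a => let x := reify val a in constr:(Halve n x)
  | _ *: ?a => let x := reify val a in constr:(Halve 1 x)
  | 1 => constr:(Const 1)
  | ?n%:R => constr:(Const n)
  | val ?g => constr:(Letter g)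
  end.

Ltac decide_equality val sound :=
  match goal with
  | |- ?s = ?t =>
    let e := reify val s in let f := reify val t in apply: (sound e f);
    vm_compute; reflexivity
  end.

(** * The Casimir elements and their images *)

Section Casimir.
Context (F : fieldType).

(** Cyclic rotation of [A], [B], [C] permutes alpha, beta, gamma by mere unfolding, so one formula
    yields all three elements; only delta has its summands reordered. *)
Definition casimir (R : algType F) (A B C D : R) : R :=
  D ^+ 2 + 2^-1 *: (B * A * C + C * A * B) + A ^+ 2
  + B * racah_gamma A B C D - C * racah_beta A B C D - A * racah_delta A B C.

Lemma casimir_morph (R S : algType F) (f : {lrmorphism R -> S}) A B C D :
  f (casimir R A B C D) = casimir S (f A) (f B) (f C) (f D).
Proof.
rewrite /casimir /racah_beta /racah_gamma /racah_delta /commutator.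
by rewrite !(rmorphD, rmorphN, rmorphM) /= linearZ /= !(rmorphD, rmorphM).
Qed.

Lemma racah_delta_rot (R : nzRingType) (A B C : R) :
  racah_delta B C A = racah_delta A B C.
Proof. by rewrite /racah_delta addrC addrA. Qed.

Lemma Omega_AE : Omega_A F =
  casimir (racah F) (racah_elt F GA) (racah_elt F GB)
    (racah_elt F GC) (racah_elt F GD).
Proof. by []. Qed.

Lemma Omega_BE : Omega_B F =
  casimir (racah F) (racah_elt F GB) (racah_elt F GC)
    (racah_elt F GA) (racah_elt F GD).
Proof. by rewrite /casimir racah_delta_rot. Qed.

Lemma Omega_CE : Omega_C F =
  casimir (racah F) (racah_elt F GC) (racah_elt F GA)
    (racah_elt F GB) (racah_elt F GD).
Proof. by rewrite /casimir -racah_delta_rot. Qed.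

Context (R : algType F).

Definition casimir_factor (k l m i : R) : R :=
  4 * i ^+ 2 - 8 * i - 4 * k - 4 * l - 4 * m + 7.

Definition casimir_shift (k l m i : R) : R :=
  4096^-1 *: (3 * (2 * i + 3) * (2 * i + 1) * (2 * i - 5) * (2 * i - 7))
  - 512^-1 *: ((2 * i + 1) * (6 * i - 13) * (k + l + m))
  + 64^-1 *: ((k + l + m) * (k + l + m + 4))
  - 512^-1 *: ((2 * i - 3) * (k * l + l * m + m * k))
  + 256^-1 *: (k * l * m).

Definition racah_image (X : R) : R := 16^-1 *: ((2 * X - 3) * (2 * X + 1)).

Lemma casimir_racah_image (X Y Z : R) : 2 != 0 :> F -> bi_laws X Y Z ->
  let k := bi_kappa X Y Z in
  let l := bi_lambda X Y Z in
  let m := bi_mu X Y Z in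
  let i := bi_iota X Y Z in
  let A := racah_image X in
  let B := racah_image Y in
  let C := racah_image Z in
  let D := 2^-1 *: commutator A B in
  let P := casimir_factor k l m i in
  let Gamma := casimir_shift k l m i in
  [/\ casimir R A B C D = 1024^-1 *: (l * (l - 2 * i + 3) * P) - Gamma,
      casimir R B C A D = 1024^-1 *: (m * (m - 2 * i + 3) * P) - Gamma
    & casimir R C A B D = 1024^-1 *: (k * (k - 2 * i + 3) * P) - Gamma].
Proof.
move=> nz2 laws k l m i A B C D P Gamma.
(* Every denominator becomes a power of 1/2, the form that [Halve] represents. *)
have half n : (2 ^ n)%:R^-1 = 2^-1 ^+ n :> F by rewrite natrX exprVn.
have h16 : 16^-1 = 2^-1 ^+ 4 :> F := half 4%N.
have h64 : 64^-1 = 2^-1 ^+ 6 :> F := half 6%N.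
have h256 : 256^-1 = 2^-1 ^+ 8 :> F := half 8%N.
have h512 : 512^-1 = 2^-1 ^+ 9 :> F := half 9%N.
have h1024 : 1024^-1 = 2^-1 ^+ 10 :> F := half 10%N.
have h4096 : 4096^-1 = 2^-1 ^+ 12 :> F := half 12%N.
rewrite {}/P {}/Gamma {}/D {}/A {}/B {}/C {}/i.
rewrite /casimir /casimir_factor /casimir_shift.
rewrite /racah_beta /racah_gamma /racah_delta /commutator /racah_image /bi_iota.
rewrite h16 h64 h256 h512 h1024 h4096.
pose v := bi_val X Y Z.
(* Kappa, lambda, mu become letters of their own, unexpanded, so that the rules move them as central
   elements. *)
rewrite -[k]/(v 0%N) -[l]/(v 1%N) -[m]/(v 2%N).
rewrite -[X]/(v 3%N) -[Y]/(v 4%N) -[Z]/(v 5%N).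
have vP : forall g h p, bi_rule g h = Some p -> v g * v h = ncpoly_eval v p.
  exact: bi_ruleP.
(* Too little fuel could only make the test fail, so 100 is just a generous bound. *)
have sound := equal_mod_sound bi_rule F R v nz2 vP 100.
by split; decide_equality v sound.
Qed.
End Casimir.

Theorem proposition6p7 (F : fieldType) (charF : 2%N \notin [pchar F])
    (zeta : {lrmorphism racah F -> bannai_ito F}) :
  let X : bannai_ito F := bi_elt F GX in
  let Y : bannai_ito F := bi_elt F GY in
  let Z : bannai_ito F := bi_elt F GZ in
  let kappa := bi_kappa X Y Z in
  let lambda := bi_lambda X Y Z in
  let mu := bi_mu X Y Z in
  let iota := bi_iota X Y Z in
  let Gamma :=
    4096^-1 *: (3 * (2 * iota + 3) * (2 * iota + 1)
                * (2 * iota - 5) * (2 * iota - 7))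
    - 512^-1 *: ((2 * iota + 1) * (6 * iota - 13) * (kappa + lambda + mu))
    + 64^-1 *: ((kappa + lambda + mu) * (kappa + lambda + mu + 4))
    - 512^-1 *: ((2 * iota - 3)
                 * (kappa * lambda + lambda * mu + mu * kappa))
    + 256^-1 *: (kappa * lambda * mu) in
  let P := 4 * iota ^+ 2 - 8 * iota - 4 * kappa - 4 * lambda - 4 * mu + 7 in
  zeta (racah_elt F GA) = 16^-1 *: ((2 * X - 3) * (2 * X + 1)) ->
  zeta (racah_elt F GB) = 16^-1 *: ((2 * Y - 3) * (2 * Y + 1)) ->
  zeta (racah_elt F GC) = 16^-1 *: ((2 * Z - 3) * (2 * Z + 1)) ->
  [/\ zeta (Omega_A F) =
        1024^-1 *: (lambda * (lambda - 2 * iota + 3) * P) - Gamma,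
      zeta (Omega_B F) =
        1024^-1 *: (mu * (mu - 2 * iota + 3) * P) - Gamma
    & zeta (Omega_C F) =
        1024^-1 *: (kappa * (kappa - 2 * iota + 3) * P) - Gamma].
Proof.
move=> X Y Z kappa lambda mu iota Gamma P zA zB zC.
have nz2 : 2 != 0 :> F by move: charF; rewrite inE /=.
have [AB _ _ _] := racah_eltP F.
(* The values of [zeta] are prescribed on [A], [B], [C] only; $[A,B]=2D$ with 2 invertible
   determines the image of [D]. *)
have zD : zeta (racah_elt F GD) =
    2^-1 *: commutator (zeta (racah_elt F GA)) (zeta (racah_elt F GB)).
  rewrite -Defs.rmorph_comm AB rmorphM rmorph_nat mulr_natl -scaler_nat scalerA.
  by rewrite mulVf // scale1r.
rewrite Omega_AE Omega_BE Omega_CE !casimir_morph zD zA zB zC.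
exact: (casimir_racah_image F _ X Y Z nz2 (@bi_eltP F)).
Qed.
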